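(* Let $n$ be a positive integer. Let $c^{-1}(\overline{\mathfrak{C}}_n)$ be the set of all permutations $\phi\in S_n$ whose characteristic sequence $c(\phi)$ is strictly increasing. There exists a function $\gamma:c^{-1}(\overline{\mathfrak{C}}_n)\to \mathcal{T}_n$ such that for all $\phi\in c^{-1}(\overline{\mathfrak{C}}_n)$, $(s\circ\gamma)(\phi) = (\alpha\circ c)(\phi)$.
   Context: $Z_n=\{0,1,\dots,n-1\}$, and $S_n$ is the set of permutations of $Z_n$. For $\phi\in S_n$, the characteristic sequence $c(\phi)$ is the nondecreasing sequence formed from the multiset $\{i+\phi(i): i\in Z_n\}$. $\overline{\mathfrak{C}}_n$ is the set of strictly increasing sequences of the form $c(\phi)$, $\phi\in S_n$. $\mathcal{T}_n$ is the set of tournaments on vertex set $Z_n$ (digraphs in which, for each pair of distinct vertices $x,y$, exactly one of $(x,y),(y,x)$ is an edge). For $T\in\mathcal{T}_n$, the score sequence $s(T)$ is the nondecreasing sequence formed from the multiset of outdegrees of the vertices of $T$. For a strictly increasing integer sequence $(s_0,\dots,s_{n-1})$, $\alpha(s_0,\dots,s_{n-1})=(s_0-0,s_1-1,\dots,s_{n-1}-(n-1))$. *)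

(* Defs.v *)
From mathcomp Require Import all_boot all_order all_fingroup all_algebra.

Set Implicit Arguments.
Unset Strict Implicit.
Unset Printing Implicit Defensive.

Import GRing.Theory.

(* Z_n is 'I_n, and S_n is 'S_n = {perm 'I_n}. *)

Definition char_seq (n : nat) (phi : 'S_n) : seq nat :=
  sort leq [seq (i + phi i)%N | i : 'I_n].

Definition strict_char_seqs (n : nat) : pred (seq nat) :=
  [pred s | sorted ltn s & [exists phi : 'S_n, s == char_seq phi]].

Definition char_preim (n : nat) : {set 'S_n} :=
  [set phi | char_seq phi \in strict_char_seqs n].

Lemma in_char_preim (n : nat) (phi : 'S_n) :
  (phi \in char_preim n) = sorted ltn (char_seq phi).
Proof.
by rewrite inE inE andb_idr // => _; apply/existsP; exists phi.
Qed.

(* A digraph on 'I_n is given by its edge set; tournaments have no loops. *)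
Definition is_tournament (n : nat) (E : {set 'I_n * 'I_n}) : bool :=
  [forall x, (x, x) \notin E] &&
  [forall x, forall y, (x != y) ==> (((x, y) \in E) (+) ((y, x) \in E))].

Definition tournament (n : nat) : Type :=
  {E : {set 'I_n * 'I_n} | is_tournament E}.

Definition outdegree (n : nat) (T : tournament n) (x : 'I_n) : nat :=
  #|[set y | (x, y) \in val T]|.

Definition score_seq (n : nat) (T : tournament n) : seq nat :=
  sort leq [seq outdegree T x | x : 'I_n].

(* Integer-valued, so that the subtraction is not truncated. *)
Definition alpha (s : seq int) : seq int :=
  mkseq (fun k => s`_k - k%:Z)%R (size s).

(* Main.v *)
(* For i <> j put an edge from i to j when
     [j < i] + [phi j < phi i] - [c j < c i] = 1,  where c i = i + phi i.
   As c is injective, exactly one of the two orientations gives 1 and the other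
   gives 0.  Summing over j, the outdegree of i is i + phi i minus the rank of
   c i, that is, the entry of alpha (c phi) at the position of c i. *)
Require Import Defs.
From mathcomp Require Import all_boot all_order all_fingroup all_algebra.
From mathcomp Require Import zify.

Set Implicit Arguments.
Unset Strict Implicit.
Unset Printing Implicit Defensive.

Section PermTournament.
Variables (n : nat) (phi : 'S_n).

Definition perm_edges : {set 'I_n * 'I_n} :=
  [set p : 'I_n * 'I_n |
    (p.2 < p.1) + (phi p.2 < phi p.1)
      == (p.2 + phi p.2 < p.1 + phi p.1).+1].

Hypothesis phi_strict : sorted ltn (char_seq phi).

Lemma char_inj : injective (fun i : 'I_n => i + phi i).
Proof.
apply/injectiveP; rewrite /injectiveb /dinjectiveb -(sort_uniq leq).
exact: sorted_uniq ltn_trans ltnn _ phi_strict.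
Qed.

(** The difference of brackets is never 2 or -1: if both comparisons on the right hold, so does the
    one between sums, and the latter forces at least one of them. Written additively to avoid
    truncated subtraction. *)
Lemma perm_edgesE (x y : 'I_n) :
  ((x, y) \in perm_edges) + (y + phi y < x + phi x)
    = (y < x) + (phi y < phi x).
Proof. by rewrite inE /=; lia. Qed.

Lemma perm_edges_tournament : is_tournament perm_edges.
Proof.
apply/andP; split; first by apply/forallP => x; rewrite inE /= !ltnn.
apply/forallP => x; apply/forallP => y; apply/implyP => neq_xy.
have neq_phi : phi x != phi y :> nat by rewrite (inj_eq val_inj) (inj_eq perm_inj).
have neq_c : x + phi x != y + phi y by rewrite (inj_eq char_inj).
move: neq_xy; rewrite -val_eqE /= => neq_xy.
have := perm_edgesE x y; have := perm_edgesE y x.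
by case: (_ \in _); case: (_ \in _) => /=; lia.
Qed.

Definition perm_tournament : tournament n :=
  exist _ perm_edges perm_edges_tournament.

Lemma sum_ltn_ord (i : 'I_n) : \sum_(j < n) (j < i : nat) = i.
Proof.
rewrite -[RHS]card_ord -sum1_card (big_ord_widen n (fun=> 1)) 1?ltnW //.
by rewrite [RHS]big_mkcond.
Qed.

Lemma count_char_seq (x : 'I_n) :
  count (fun c => c < x + phi x) (char_seq phi)
    = \sum_(y < n) (y + phi y < x + phi x : nat).
Proof.
rewrite (seq.permP (permEl (perm_sort _ _))) count_map -sum1_count.
by rewrite big_mkcond /= big_enum.
Qed.

Lemma outdegree_perm_tournament (x : 'I_n) :
  outdegree perm_tournament x + index (x + phi x) (char_seq phi) = x + phi x.
Proof.
have c_in : x + phi x \in char_seq phi.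
  by rewrite mem_sort; apply/mapP; exists x; rewrite ?mem_enum.
(* In a strictly increasing sequence, the position of an entry is the number of smaller entries. *)
have -> : index (x + phi x) (char_seq phi)
            = count (fun c => c < x + phi x) (char_seq phi).
  have := @Order.POrderTheory.count_lt_nth _ nat 0 (char_seq phi)
    (index (x + phi x) (char_seq phi)).
  by rewrite nth_index // index_mem c_in => <-.
rewrite count_char_seq /outdegree -sum1_card.
rewrite (big_mkcond (fun y => y \in _)) /= -big_split /=.
under eq_bigr => y _ do rewrite inE -[if _ then _ else _]/(nat_of_bool _) perm_edgesE.
rewrite big_split /= sum_ltn_ord; congr (_ + _).
(* Reindexing along the bijection [phi] shows that exactly [phi x] indices [y] satisfy
   [phi y < phi x]. *)
by rewrite -[RHS]sum_ltn_ord [RHS](reindex_inj (@perm_inj _ phi)).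
Qed.

End PermTournament.

(** Ensures that the truncated differences [nth 0 s k - k] agree with the integer ones in
    [alpha]. *)
Lemma sorted_ltn_geq_index (s : seq nat) k :
  sorted ltn s -> k < size s -> k <= nth 0 s k.
Proof.
move=> s_lt; elim: k => // k IHk lt_k.
exact: leq_ltn_trans (IHk (ltnW lt_k)) (sortedP 0 s_lt k lt_k).
Qed.

Lemma score_seq_perm_tournament (n : nat) (phi : 'S_n)
    (phi_strict : sorted ltn (char_seq phi)) :
  score_seq (perm_tournament phi_strict)
    = mkseq (fun k => nth 0 (char_seq phi) k - k) (size (char_seq phi)).
Proof.
set s := char_seq phi.
have s_uniq : uniq s := sorted_uniq ltn_trans ltnn phi_strict.
(* Expressing each term through the value [c] instead of its position makes the sequence a map over
   [s], so the sorting inside [s] can be undone up to permutation. *)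
have sub_index : mkseq (fun k => nth 0 s k - k) (size s)
                   = [seq c - index c s | c <- s].
  rewrite -[in RHS](mkseq_nth 0 s) -map_comp; apply/eq_in_map => k /=.
  by rewrite mem_iota /= mkseq_nth => lt_k; rewrite index_uniq.
apply: (sorted_eq leq_trans anti_leq); first exact: sort_sorted leq_total _.
  (* Strict increase of [s] by at least 1 per step absorbs the growth of [k], so the differences are
     nondecreasing. *)
  apply/(sortedP 0) => k; rewrite size_mkseq => lt_k.
  rewrite !nth_mkseq ?(ltnW lt_k) //.
  by have := sortedP 0 phi_strict k lt_k; rewrite -/s /=; lia.
rewrite sub_index perm_sort perm_sym.
apply: perm_trans (perm_map _ (permEl (perm_sort leq _))) _.
rewrite -map_comp (eq_map (g := outdegree (perm_tournament phi_strict))) // => x.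
by rewrite /= -[X in X - _](outdegree_perm_tournament phi_strict) addnK.
Qed.

Theorem theorem3p4 (n : nat) (n_gt0 : (0 < n)%N) :
  exists gamma : {phi : 'S_n | phi \in char_preim n} -> tournament n,
    forall phi : {phi : 'S_n | phi \in char_preim n},
      map Posz (score_seq (gamma phi)) = alpha (map Posz (char_seq (val phi))).
Proof.
have strict (phi : {phi : 'S_n | phi \in char_preim n}) :
  sorted ltn (char_seq (val phi)) by rewrite -in_char_preim (valP phi).
exists (fun phi => perm_tournament (strict phi)) => phi.
rewrite score_seq_perm_tournament /alpha size_map -map_comp.
apply/eq_in_map => k; rewrite mem_iota /= => lt_k.
by rewrite (nth_map 0) // subzn //; apply: sorted_ltn_geq_index (strict phi) lt_k.
Qed.
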